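(* For every 3-periodic of $\mathcal{E}$, the focus-inversive triangle is a 3-periodic billiard trajectory of its $X_9^\dagger$-centered circumellipse $\mathcal{C}^\dagger$, i.e. at each vertex of the focus-inversive triangle the normal to $\mathcal{C}^\dagger$ bisects the angle formed by the two sides meeting there. Since the semi-axes of $\mathcal{C}^\dagger$ do not depend on the 3-periodic, in a coordinate system centered at $X_9^\dagger$ and aligned with the axes of $\mathcal{C}^\dagger$ the focus-inversive triangles form a family of 3-periodic billiard trajectories of one fixed ellipse.
   Context: Let $a>b>0$ and let $\mathcal{E}$ be the ellipse $x^2/a^2+y^2/b^2=1$ (the elliptic billiard). Set $c=\sqrt{a^2-b^2}$, and let the foci be $f_1=(-c,0)$, $f_2=(c,0)$. A 3-periodic of an ellipse is a triangle with vertices on the ellipse such that at each vertex the normal to the ellipse bisects the angle formed by the two sides meeting at that vertex; for $\mathcal{E}$ these form a one-parameter family (there is one through every point of $\mathcal{E}$). Fix $\rho>0$. The focus-inversive triangle of a 3-periodic $P_1P_2P_3$ of $\mathcal{E}$ is the triangle with vertices $P_i^\dagger=f_1+(\rho/d_{1,i})^2(P_i-f_1)$, where $d_{1,i}=|P_i-f_1|$. The Mittenpunkt $X_9^\dagger$ is the point of concurrence of the lines joining each excenter of the focus-inversive triangle to the midpoint of the corresponding side, and $\mathcal{C}^\dagger$ denotes the unique circumellipse of the focus-inversive triangle centered at $X_9^\dagger$. Its semi-axes are invariant over the family (with explicit values depending only on $a,b,\rho$). *)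

(* Defs.v *)
From Stdlib Require Import Reals.
Open Scope R_scope.

Definition pt := (R * R)%type.

Definition padd (p q : pt) : pt := (fst p + fst q, snd p + snd q).
Definition psub (p q : pt) : pt := (fst p - fst q, snd p - snd q).
Definition pscale (k : R) (p : pt) : pt := (k * fst p, k * snd p).
Definition dot (p q : pt) : R := fst p * fst q + snd p * snd q.
Definition cross (p q : pt) : R := fst p * snd q - snd p * fst q.
Definition norm (p : pt) : R := sqrt (dot p p).
Definition dist (p q : pt) : R := norm (psub p q).
Definition perp (p : pt) : pt := (- snd p, fst p).
Definition midpoint (p q : pt) : pt := pscale (/2) (padd p q).

(* ---------- Ellipses ----------
   The ellipse with center c, major/minor axis directions u, perp u
   (u a unit vector) and semi-axes A (along u), B (along perp u):
     ((p-c).u)^2/A^2 + ((p-c).u^perp)^2/B^2 = 1. *)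
Definition is_ellipse (c u : pt) (A B : R) : Prop :=
  norm u = 1 /\ 0 < A /\ 0 < B.

Definition on_ellipse (c u : pt) (A B : R) (p : pt) : Prop :=
  (dot (psub p c) u) ^ 2 / A ^ 2 + (dot (psub p c) (perp u)) ^ 2 / B ^ 2 = 1.

(* A normal vector to that ellipse at p (half the gradient of its equation). *)
Definition ellipse_normal (c u : pt) (A B : R) (p : pt) : pt :=
  padd (pscale (dot (psub p c) u / A ^ 2) u)
       (pscale (dot (psub p c) (perp u) / B ^ 2) (perp u)).

(* The line through p in direction n bisects the angle q p r:
   n makes equal angles with the sides p->q and p->r. *)
Definition bisects_angle (n p q r : pt) : Prop :=
  dot n (psub q p) / dist q p = dot n (psub r p) / dist r p.

Definition is_3periodic (c u : pt) (A B : R) (P1 P2 P3 : pt) : Prop :=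
  P1 <> P2 /\ P2 <> P3 /\ P3 <> P1 /\
  on_ellipse c u A B P1 /\ on_ellipse c u A B P2 /\ on_ellipse c u A B P3 /\
  bisects_angle (ellipse_normal c u A B P1) P1 P2 P3 /\
  bisects_angle (ellipse_normal c u A B P2) P2 P3 P1 /\
  bisects_angle (ellipse_normal c u A B P3) P3 P1 P2.

(* The elliptic billiard x^2/a^2 + y^2/b^2 = 1 is the ellipse centered at
   the origin with axes along the coordinate axes. *)
Definition origin : pt := (0, 0).
Definition e1 : pt := (1, 0).

Definition focus1 (a b : R) : pt := (- sqrt (a ^ 2 - b ^ 2), 0).

Definition invert (f : pt) (rho : R) (p : pt) : pt :=
  padd f (pscale ((rho / dist p f) ^ 2) (psub p f)).

(* ---------- Triangle centers ----------
   Excenter of triangle (P,Q,R) opposite the vertex P (center of the excircle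
   tangent to side QR), in the standard barycentric form
   (-l_P P + l_Q Q + l_R R)/(-l_P + l_Q + l_R), l_X the length of the side
   opposite X. *)
Definition excenter (P Q R : pt) : pt :=
  let lP := dist Q R in let lQ := dist R P in let lR := dist P Q in
  pscale (/ (- lP + lQ + lR))
    (padd (pscale (- lP) P) (padd (pscale lQ Q) (pscale lR R))).

Definition on_line (p q x : pt) : Prop := cross (psub q p) (psub x p) = 0.

Definition is_mittenpunkt (P1 P2 P3 X : pt) : Prop :=
  on_line (excenter P1 P2 P3) (midpoint P2 P3) X /\
  on_line (excenter P2 P3 P1) (midpoint P3 P1) X /\
  on_line (excenter P3 P1 P2) (midpoint P1 P2) X.

Definition is_circumellipse (c u : pt) (A B : R) (P1 P2 P3 : pt) : Prop :=
  is_ellipse c u A B /\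
  on_ellipse c u A B P1 /\ on_ellipse c u A B P2 /\ on_ellipse c u A B P3.

(* Main.v *)
Require Import Defs.
From Stdlib Require Import Reals Lra Psatz Classical.
(* Reals also exports a [dist] and must not shadow the one of Defs. *)
Import Defs.
Open Scope R_scope.

(* For a triangle with sides l_i, the ellipse centered at the Mittenpunkt is
   forced: the vectors w_i from the center to the vertices, in coordinates where
   the ellipse is the unit circle, satisfy sum m_i w_i = 0 with
   m_i = l_i (l_j + l_k - l_i), so 1 - w_i.w_j = M / (2 l_i l_j) with
   M = sum m_i.  Dividing by the side l_k joining the vertices i, j gives
   M / (2 l_1 l_2 l_3), the same for all pairs, and this is the billiard law.
   The same Gram matrix expresses the semi-axes through the perimeter p and
   r = M / (l_1 l_2 l_3) only.

   For a 3-periodic of the elliptic billiard, (1 - w_i.w_j) / l_k is a common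
   constant kap.  Squaring puts the w_i in Poncelet position: with
   k = (kap c)^2, the points z_j on the unit circle are the roots of
   z^3 + k s z^2 - k z - s = 0 for some |s| = 1.  This determines kap from a, b.
   As d_{1,i} = a + c Re z_i and the sides of the inversive triangle are
   rho^2 l_k / (d_{1,i} d_{1,j}), its p and r become rational expressions in the
   elementary symmetric functions of the Re z_i, from which s cancels. *)

(** * Equalities as linear combinations of hypotheses *)

Lemma Req_sub (x y s : R) : s = 0 -> x - y = s -> x = y.
Proof. lra. Qed.

(** Nested uses, closed by [eq_refl : 0 = 0], build a weighted sum of hypotheses; with [Req_sub]
    only a polynomial identity remains. *)
Lemma lincomb (c l r s : R) : l = r -> s = 0 -> c * (l - r) + s = 0.
Proof. intros -> ->; ring. Qed.

Arguments lincomb c {l r s}.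

Ltac lincomb1 c1 H1 := apply (Req_sub _ _ _ (lincomb c1 H1 eq_refl)); (ring || field).
Ltac lincomb2 c1 H1 c2 H2 :=
  apply (Req_sub _ _ _ (lincomb c1 H1 (lincomb c2 H2 eq_refl))); (ring || field).
Ltac lincomb3 c1 H1 c2 H2 c3 H3 :=
  apply (Req_sub _ _ _ (lincomb c1 H1 (lincomb c2 H2 (lincomb c3 H3 eq_refl)))); (ring || field).
Ltac lincomb6 c1 H1 c2 H2 c3 H3 c4 H4 c5 H5 c6 H6 :=
  apply (Req_sub _ _ _
    (lincomb c1 H1 (lincomb c2 H2 (lincomb c3 H3
      (lincomb c4 H4 (lincomb c5 H5 (lincomb c6 H6 eq_refl))))))); (ring || field).

(** * Poncelet triangles on the unit circle *)

Lemma Rsum_sqr_gt0 (x y : R) : x <> 0 \/ y <> 0 -> 0 < x ^ 2 + y ^ 2.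
Proof. intros [H | H]; nra. Qed.

Lemma unit_dot_lt1 (X1 Y1 X2 Y2 : R) :
  X1 ^ 2 + Y1 ^ 2 = 1 -> X2 ^ 2 + Y2 ^ 2 = 1 -> X1 <> X2 \/ Y1 <> Y2 ->
  X1 * X2 + Y1 * Y2 < 1.
Proof.
intros U1 U2 N.
assert (0 < (X1 - X2) ^ 2 + (Y1 - Y2) ^ 2)
  by (apply Rsum_sqr_gt0; destruct N; [left | right]; lra).
nra.
Qed.

(** The hypotheses are the real and imaginary parts of (a + i b)(x + i y) = 0; multiply by the
    conjugate of a + i b. *)
Lemma Cmult_integral_R (a b x y : R) :
  a <> 0 \/ b <> 0 -> a * x - b * y = 0 -> a * y + b * x = 0 -> x = 0 /\ y = 0.
Proof.
intros N H1 H2.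
assert (D := Rsum_sqr_gt0 _ _ N).
split; apply Rmult_eq_reg_l with (a ^ 2 + b ^ 2); try lra.
- lincomb2 a H1 b H2.
- lincomb2 (- b) H1 a H2.
Qed.

(** Subtracting the chord equations makes ((1 - k) X1, (1 + k) Y1) orthogonal to w_2 - w_3. So is
    w_2 + w_3, the norms being equal; in the plane the two are then parallel. *)
Lemma unit_chord_parallel (k gam X1 Y1 X2 Y2 X3 Y3 : R) :
  X2 ^ 2 + Y2 ^ 2 = 1 -> X3 ^ 2 + Y3 ^ 2 = 1 -> X2 <> X3 \/ Y2 <> Y3 ->
  (1 - k) * (X1 * X2) + (1 + k) * (Y1 * Y2) = gam ->
  (1 - k) * (X3 * X1) + (1 + k) * (Y3 * Y1) = gam ->
  (1 - k) * X1 * (Y2 + Y3) = (1 + k) * Y1 * (X2 + X3).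
Proof.
intros U2 U3 N H2 H3.
assert (D : 0 < (X2 - X3) ^ 2 + (Y2 - Y3) ^ 2)
  by (apply Rsum_sqr_gt0; destruct N; [left | right]; lra).
apply Rmult_eq_reg_l with ((X2 - X3) ^ 2 + (Y2 - Y3) ^ 2); [| lra].
assert (p : (1 - k) * X1 * (X2 - X3) + (1 + k) * Y1 * (Y2 - Y3) = 0) by lra.
assert (s : (X2 - X3) * (X2 + X3) + (Y2 - Y3) * (Y2 + Y3) = 0) by lra.
lincomb2 ((X2 - X3) * (Y2 + Y3) - (Y2 - Y3) * (X2 + X3)) p
  ((Y2 - Y3) * (1 - k) * X1 - (X2 - X3) * (1 + k) * Y1) s.
Qed.

(* With z_j = X_j + i Y_j the chord equations say that z_1, z_2, z_3 are the
   roots of k z^3 - k s1 z^2 - (1 + 2 gam) z + s1, where s1 = z_1 + z_2 + z_3: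
   hence k (z_1 z_2 + z_2 z_3 + z_3 z_1) = - (1 + 2 gam) and
   k z_1 z_2 z_3 = - s1. *)
Lemma chord_triangle_sym (k gam X1 Y1 X2 Y2 X3 Y3 : R) :
  X1 ^ 2 + Y1 ^ 2 = 1 -> X2 ^ 2 + Y2 ^ 2 = 1 -> X3 ^ 2 + Y3 ^ 2 = 1 ->
  X1 <> X2 \/ Y1 <> Y2 -> X2 <> X3 \/ Y2 <> Y3 -> X3 <> X1 \/ Y3 <> Y1 ->
  (1 - k) * (X1 * X2) + (1 + k) * (Y1 * Y2) = gam ->
  (1 - k) * (X2 * X3) + (1 + k) * (Y2 * Y3) = gam ->
  (1 - k) * (X3 * X1) + (1 + k) * (Y3 * Y1) = gam ->
  k * (X1 * X2 + X2 * X3 + X3 * X1 - (Y1 * Y2 + Y2 * Y3 + Y3 * Y1))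
    = - (1 + 2 * gam) /\
  k * (X1 * X2 * X3 - X1 * Y2 * Y3 - X2 * Y3 * Y1 - X3 * Y1 * Y2)
    = - (X1 + X2 + X3) /\
  k * (Y1 * X2 * X3 + X1 * Y2 * X3 + X1 * X2 * Y3 - Y1 * Y2 * Y3)
    = - (Y1 + Y2 + Y3).
Proof.
intros U1 U2 U3 N12 N23 N31 E12 E23 E31.
assert (I1 := unit_chord_parallel k gam X1 Y1 X2 Y2 X3 Y3 U2 U3 N23 E12 E31).
assert (I2 := unit_chord_parallel k gam X2 Y2 X3 Y3 X1 Y1 U3 U1 N31 E23 E12).
assert (G1 : (X2 + X3) * ((1 - k) * X1) + (Y2 + Y3) * ((1 + k) * Y1) = 2 * gam)
  by lra.
assert (G2 : (X3 + X1) * ((1 - k) * X2) + (Y3 + Y1) * ((1 + k) * Y2) = 2 * gam)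
  by lra.
clear E12 E23 E31.
(* [G1] and [I1] are the two parts of (z_2 + z_3)(1 - k z_1^2) = 2 gam z_1, up to the unit factor
   z_1. Subtracting the analogue for z_2 leaves a multiple of z_1 - z_2, which can be cancelled. *)
assert (K : k * (X1 * X2 + X2 * X3 + X3 * X1 - (Y1 * Y2 + Y2 * Y3 + Y3 * Y1))
    + (1 + 2 * gam) = 0 /\
  k * (X1 * Y2 + X2 * Y1 + X2 * Y3 + X3 * Y2 + X3 * Y1 + X1 * Y3) = 0).
{ apply (Cmult_integral_R (X1 - X2) (Y1 - Y2)).
  - destruct N12; [left | right]; lra.
  - lincomb6 (- X1) G1 Y1 I1 (X2 + X3) U1 X2 G2 (- Y2) I2 (- (X1 + X3)) U2.
  - lincomb6 (- Y1) G1 (- X1) I1 (Y2 + Y3) U1 Y2 G2 X2 I2 (- (Y1 + Y3)) U2. }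
destruct K as [Kx Ky].
split; [lra | split].
- apply (Req_sub _ _ _ (lincomb X1 G1 (lincomb (- Y1) I1 (lincomb (- (X2 + X3)) U1
    (lincomb X1 Kx (lincomb (- Y1) Ky eq_refl)))))); ring.
- apply (Req_sub _ _ _ (lincomb Y1 G1 (lincomb X1 I1 (lincomb (- (Y2 + Y3)) U1
    (lincomb Y1 Kx (lincomb X1 Ky eq_refl)))))); ring.
Qed.

(** Moduli in k z_1 z_2 z_3 = - s1 give |s1| = k, and |s1|^2 = 1 + 2 gam fixes gam. The bound on gam
    then yields k < 2, so that the factor 2 - k cancels in the last equation. *)
Lemma chord_triangle (k gam X1 Y1 X2 Y2 X3 Y3 : R) :
  0 < k -> gam < 3 / 2 ->
  X1 ^ 2 + Y1 ^ 2 = 1 -> X2 ^ 2 + Y2 ^ 2 = 1 -> X3 ^ 2 + Y3 ^ 2 = 1 ->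
  X1 <> X2 \/ Y1 <> Y2 -> X2 <> X3 \/ Y2 <> Y3 -> X3 <> X1 \/ Y3 <> Y1 ->
  (1 - k) * (X1 * X2) + (1 + k) * (Y1 * Y2) = gam ->
  (1 - k) * (X2 * X3) + (1 + k) * (Y2 * Y3) = gam ->
  (1 - k) * (X3 * X1) + (1 + k) * (Y3 * Y1) = gam ->
  2 * gam = k ^ 2 - 1 /\
  4 * (X1 * X2 + X2 * X3 + X3 * X1) = (k - 3) * (k + 1) /\
  4 * k * (X1 * X2 * X3) = - (1 + k) ^ 2 * (X1 + X2 + X3).
Proof.
intros k0 g0 U1 U2 U3 N12 N23 N31 E12 E23 E31.
destruct (chord_triangle_sym k gam X1 Y1 X2 Y2 X3 Y3) as [S2 [Tx Ty]]; auto.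
assert (Hs : (X1 + X2 + X3) ^ 2 + (Y1 + Y2 + Y3) ^ 2 = k ^ 2).
{ transitivity (k ^ 2 * ((X1 ^ 2 + Y1 ^ 2) * (X2 ^ 2 + Y2 ^ 2) * (X3 ^ 2 + Y3 ^ 2))).
  - replace (X1 + X2 + X3) with (- - (X1 + X2 + X3)) by ring.
    replace (Y1 + Y2 + Y3) with (- - (Y1 + Y2 + Y3)) by ring.
    rewrite <- Tx, <- Ty; ring.
  - rewrite U1, U2, U3; ring. }
assert (Hg : 2 * gam = k ^ 2 - 1) by lra.
assert (k2 : k < 2) by (clear - k0 g0 Hg; nra).
assert (Hd : X1 * X2 + X2 * X3 + X3 * X1 - (Y1 * Y2 + Y2 * Y3 + Y3 * Y1) = - k).
{ apply Rmult_eq_reg_l with k; lra. }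
split; [exact Hg | split; [lra |]].
apply Rmult_eq_reg_l with (2 - k); [| lra].
apply (Req_sub _ _ _ (lincomb (2 * (1 + k)) Tx (lincomb (2 * k * X3) E12
  (lincomb (2 * k * X1) E23 (lincomb (2 * k * X2) E31
  (lincomb (k * (X1 + X2 + X3)) Hg eq_refl)))))); ring.
Qed.

(** Here s2 is constant and s3 a multiple of s1, so s1 alone varies. Both w1 + w2 + w3 and d1 d2 d3
    are multiples of a (3 - k) + 2 c s1, which drops out of their quotient. *)
Lemma chord_family (a c k m h X1 X2 X3 : R) :
  m * (1 + k) = 2 * k -> h = (3 - k) / 2 -> 0 < k < 1 ->
  c ^ 2 * ((3 - k) * (k + 1)) = 4 * k * a ^ 2 ->
  4 * (X1 * X2 + X2 * X3 + X3 * X1) = (k - 3) * (k + 1) ->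
  4 * k * (X1 * X2 * X3) = - (1 + k) ^ 2 * (X1 + X2 + X3) ->
  let d1 := a + c * X1 in let d2 := a + c * X2 in let d3 := a + c * X3 in
  let l1 := h - m * (X2 * X3) in
  let l2 := h - m * (X3 * X1) in
  let l3 := h - m * (X1 * X2) in
  let w1 := l1 * d1 in let w2 := l2 * d2 in let w3 := l3 * d3 in
  (w1 + w2 + w3) * (2 * a ^ 2 * (1 - k)) = (3 + k) * (3 - k) * (d1 * d2 * d3) /\
  (4 * (w1 * w2 + w2 * w3 + w3 * w1) - (w1 + w2 + w3) ^ 2) * ((3 - k) * (1 + k))
    = 2 * a ^ 2 * (3 + k) * (1 - k) * (l1 * l2 * l3).
Proof.
intros Hm Hh Hk Hc E2 E3; cbv zeta.
set (s1 := X1 + X2 + X3) in *.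
set (s2 := X1 * X2 + X2 * X3 + X3 * X1) in *.
set (s3 := X1 * X2 * X3) in *.
assert (m2 : m * s2 = k * (k - 3) / 2).
{ apply Rmult_eq_reg_l with (1 + k); [| lra].
  lincomb2 s2 Hm (k / 2) E2. }
assert (m3 : m * s3 = - (1 + k) * s1 / 2).
{ apply Rmult_eq_reg_l with (1 + k); [| lra].
  apply (Req_sub _ _ _ (lincomb s3 Hm (lincomb (/ 2) E3 eq_refl))); field. }
assert (c2 : c ^ 2 * s2 = - k * a ^ 2) by lincomb2 (- / 4) Hc (c ^ 2 / 4) E2.
assert (c3 : (3 - k) * (c ^ 2 * s3) = - (1 + k) * a ^ 2 * s1).
{ apply Rmult_eq_reg_l with (4 * k); [| lra].
  lincomb2 (- (1 + k) * s1) Hc ((3 - k) * c ^ 2) E3. }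
assert (W : (h - m * (X2 * X3)) * (a + c * X1) + (h - m * (X3 * X1)) * (a + c * X2)
    + (h - m * (X1 * X2)) * (a + c * X3)
    = (3 + k) / 2 * (a * (3 - k) + 2 * c * s1)).
{ transitivity (3 * a * h + h * c * s1 - a * (m * s2) - 3 * c * (m * s3)).
  - unfold s1, s2, s3; ring.
  - rewrite m2, m3, Hh; field. }
assert (D : (3 - k) * ((a + c * X1) * (a + c * X2) * (a + c * X3))
    = a ^ 2 * (1 - k) * (a * (3 - k) + 2 * c * s1)).
{ transitivity ((3 - k) * (a ^ 3 + a ^ 2 * c * s1 + a * (c ^ 2 * s2))
                + c * ((3 - k) * (c ^ 2 * s3))).
  - unfold s1, s2, s3; ring.
  - rewrite c2, c3; ring. }
split; [rewrite W; lincomb1 (- (3 + k)) D |].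
(* In [Q] and [P] the terms are grouped so that s2 and s3 occur only through m s2, m s3 and c^2 s2,
   whose values are known. *)
assert (Q : (h - m * (X2 * X3)) * (a + c * X1) * ((h - m * (X3 * X1)) * (a + c * X2))
    + (h - m * (X3 * X1)) * (a + c * X2) * ((h - m * (X1 * X2)) * (a + c * X3))
    + (h - m * (X1 * X2)) * (a + c * X3) * ((h - m * (X2 * X3)) * (a + c * X1))
    = 3 * (h * a - c * (m * s3)) ^ 2
      + 2 * (h * a - c * (m * s3)) * (h * c * s1 - a * (m * s2))
      + h ^ 2 * c ^ 2 * s2 + a ^ 2 * m * s1 * (m * s3)
      - h * c * a * (s1 * (m * s2) - 3 * (m * s3))).
{ unfold s1, s2, s3; ring. }
assert (P : (h - m * (X2 * X3)) * (h - m * (X3 * X1)) * (h - m * (X1 * X2))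
    = h ^ 3 - h ^ 2 * (m * s2) + h * m * s1 * (m * s3) - m * (m * s3) ^ 2).
{ unfold s1, s2, s3; ring. }
rewrite W, Q, P, m2, m3; clear W Q P D; subst h.
replace m with (2 * k / (1 + k)) by (rewrite <- Hm; field; lra).
apply (Req_sub _ _ _ (lincomb (4 * k * s1 ^ 2) Hc
  (lincomb ((3 - k) ^ 3 * (1 + k)) c2 eq_refl))); field; lra.
Qed.

(** * Affine frame of an ellipse *)

Lemma norm_sqr (p : pt) : norm p ^ 2 = fst p ^ 2 + snd p ^ 2.
Proof.
unfold norm; rewrite pow2_sqrt; unfold dot; [ring |].
apply Rplus_le_le_0_compat; apply Rle_0_sqr.
Qed.

Lemma dist_sqr (p q : pt) :
  dist p q ^ 2 = (fst p - fst q) ^ 2 + (snd p - snd q) ^ 2.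
Proof.
unfold dist; rewrite norm_sqr; unfold psub; simpl; ring.
Qed.

Lemma dist_ge0 (p q : pt) : 0 <= dist p q.
Proof. apply sqrt_pos. Qed.

Lemma dist_sym (p q : pt) : dist p q = dist q p.
Proof. unfold dist, norm; f_equal; unfold dot, psub; simpl; ring. Qed.

Lemma dist_gt0 (p q : pt) : p <> q -> 0 < dist p q.
Proof.
intros N; destruct (dist_ge0 p q) as [|H]; auto.
exfalso; apply N.
assert (D := dist_sqr p q); rewrite <- H in D.
destruct p as [p1 p2], q as [q1 q2]; simpl fst in D; simpl snd in D.
destruct (Rplus_sqr_eq_0 (p1 - q1) (p2 - q2)); [unfold Rsqr; lra |].
f_equal; lra.
Qed.

Lemma dist_gt0_neq (p q : pt) : 0 < dist p q -> p <> q.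
Proof.
intros H E; assert (D := dist_sqr p q); rewrite E in D at 2 3; nra.
Qed.

(* Affine coordinates in which the ellipse becomes the unit circle. *)
Definition frame_x (c u : pt) (A : R) (p : pt) : R := dot (psub p c) u / A.
Definition frame_y (c u : pt) (B : R) (p : pt) : R := dot (psub p c) (perp u) / B.

Lemma is_ellipse_unit (c u : pt) (A B : R) :
  is_ellipse c u A B -> fst u ^ 2 + snd u ^ 2 = 1.
Proof.
intros [H _]; rewrite <- norm_sqr, H; ring.
Qed.

Section Frame.

Variables (c u : pt) (A B : R).
Hypothesis E : is_ellipse c u A B.

Let X := frame_x c u A.
Let Y := frame_y c u B.

Lemma frame_unit (p : pt) : on_ellipse c u A B p -> X p ^ 2 + Y p ^ 2 = 1.
Proof.
destruct E as [_ [a0 b0]]; intros <-; unfold X, Y, frame_x, frame_y; field; lra.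
Qed.

Lemma frame_dist (p q : pt) :
  dist p q ^ 2 = A ^ 2 * (X p - X q) ^ 2 + B ^ 2 * (Y p - Y q) ^ 2.
Proof.
assert (U := is_ellipse_unit _ _ _ _ E); destruct E as [_ [a0 b0]].
rewrite dist_sqr.
transitivity (((fst p - fst q) ^ 2 + (snd p - snd q) ^ 2) * (fst u ^ 2 + snd u ^ 2)).
- rewrite U; ring.
- unfold X, Y, frame_x, frame_y, dot, psub, perp; simpl; field; lra.
Qed.

Lemma frame_inj (p q : pt) : p <> q -> X p <> X q \/ Y p <> Y q.
Proof.
intros N; apply dist_gt0 in N; assert (D := frame_dist p q).
destruct (Req_dec (X p) (X q)) as [e1|]; auto.
destruct (Req_dec (Y p) (Y q)) as [e2|]; auto.
rewrite e1, e2 in D; nra.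
Qed.

Lemma frame_cross (p q : pt) :
  cross (psub p c) (psub q c) = A * B * (X p * Y q - Y p * X q).
Proof.
assert (U := is_ellipse_unit _ _ _ _ E); destruct E as [_ [a0 b0]].
transitivity (cross (psub p c) (psub q c) * (fst u ^ 2 + snd u ^ 2)).
- rewrite U; ring.
- unfold X, Y, frame_x, frame_y, dot, cross, psub, perp; simpl; field; lra.
Qed.

(** Half the gradient at p pairs with q - p to the polarized quadratic form at (p, q) minus its
    value 1 at p. *)
Lemma dot_ellipse_normal (p q : pt) :
  on_ellipse c u A B p ->
  dot (ellipse_normal c u A B p) (psub q p) = X p * X q + Y p * Y q - 1.
Proof.
intros H; rewrite <- (frame_unit p H); destruct E as [_ [a0 b0]].
unfold X, Y, frame_x, frame_y, ellipse_normal, dot, psub, padd, pscale, perp.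
simpl; field; lra.
Qed.

Lemma bisects_angle_ellipse (p q r : pt) :
  on_ellipse c u A B p ->
  bisects_angle (ellipse_normal c u A B p) p q r <->
  (X p * X q + Y p * Y q - 1) / dist p q = (X p * X r + Y p * Y r - 1) / dist p r.
Proof.
intros H; unfold bisects_angle.
rewrite !dot_ellipse_normal, (dist_sym q p), (dist_sym r p); tauto.
Qed.

End Frame.

(** The sum is twice a signed area. Were the edge vectors e, f from the first vertex parallel, the
    circle equations would give |e|^2 f = |f|^2 e, so |e|^2 = e.f = |f|^2 and e = f. *)
Lemma unit_cross_neq0 (X1 Y1 X2 Y2 X3 Y3 : R) :
  X1 ^ 2 + Y1 ^ 2 = 1 -> X2 ^ 2 + Y2 ^ 2 = 1 -> X3 ^ 2 + Y3 ^ 2 = 1 ->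
  X1 <> X2 \/ Y1 <> Y2 -> X2 <> X3 \/ Y2 <> Y3 -> X3 <> X1 \/ Y3 <> Y1 ->
  (X2 * Y3 - Y2 * X3) + (X3 * Y1 - Y3 * X1) + (X1 * Y2 - Y1 * X2) <> 0.
Proof.
intros U1 U2 U3 N12 N23 N31 D.
assert (P12 : 0 < (X2 - X1) ^ 2 + (Y2 - Y1) ^ 2)
  by (apply Rsum_sqr_gt0; destruct N12; [left | right]; lra).
assert (P23 : 0 < (X2 - X3) ^ 2 + (Y2 - Y3) ^ 2)
  by (apply Rsum_sqr_gt0; destruct N23; [left | right]; lra).
assert (P31 : 0 < (X3 - X1) ^ 2 + (Y3 - Y1) ^ 2)
  by (apply Rsum_sqr_gt0; destruct N31; [left | right]; lra).
clear N12 N23 N31.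
assert (H2 : (X2 - X1) ^ 2 + (Y2 - Y1) ^ 2 + 2 * (X1 * (X2 - X1) + Y1 * (Y2 - Y1)) = 0)
  by lra.
assert (H3 : (X3 - X1) ^ 2 + (Y3 - Y1) ^ 2 + 2 * (X1 * (X3 - X1) + Y1 * (Y3 - Y1)) = 0)
  by lra.
assert (C : (X2 - X1) * (Y3 - Y1) - (Y2 - Y1) * (X3 - X1) = 0) by lra.
replace (X2 - X3) with ((X2 - X1) - (X3 - X1)) in P23 by ring.
replace (Y2 - Y3) with ((Y2 - Y1) - (Y3 - Y1)) in P23 by ring.
set (a := X2 - X1) in *; set (b := Y2 - Y1) in *.
set (c := X3 - X1) in *; set (d := Y3 - Y1) in *.
clearbody a b c d.
assert (Ex : (a ^ 2 + b ^ 2) * c = (c ^ 2 + d ^ 2) * a)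
  by lincomb3 c H2 (- a) H3 (2 * Y1) C.
assert (Ey : (a ^ 2 + b ^ 2) * d = (c ^ 2 + d ^ 2) * b)
  by lincomb3 d H2 (- b) H3 (- 2 * X1) C.
assert (a * c + b * d = c ^ 2 + d ^ 2).
{ apply Rmult_eq_reg_l with (a ^ 2 + b ^ 2); [lincomb2 a Ex b Ey | lra]. }
assert (a * c + b * d = a ^ 2 + b ^ 2).
{ apply Rmult_eq_reg_l with (c ^ 2 + d ^ 2); [lincomb2 (- c) Ex (- d) Ey | lra]. }
lra.
Qed.

(** Any two of the three factors sum to a positive 2 l_i, so at most one is nonpositive, and a
    positive product excludes even that. *)
Lemma heron_triangle_ineq (l1 l2 l3 : R) :
  0 < l1 -> 0 < l2 -> 0 < l3 ->
  0 < (l1 + l2 + l3) * ((- l1 + l2 + l3) * (l1 - l2 + l3) * (l1 + l2 - l3)) ->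
  0 < - l1 + l2 + l3 /\ 0 < l1 - l2 + l3 /\ 0 < l1 + l2 - l3.
Proof.
intros p1 p2 p3 H.
assert (K : 0 < (- l1 + l2 + l3) * (l1 - l2 + l3) * (l1 + l2 - l3)).
{ apply Rmult_lt_reg_l with (l1 + l2 + l3); lra. }
clear H.
destruct (Rlt_le_dec 0 (- l1 + l2 + l3)) as [h1|h1];
destruct (Rlt_le_dec 0 (l1 - l2 + l3)) as [h2|h2];
destruct (Rlt_le_dec 0 (l1 + l2 - l3)) as [h3|h3]; try lra; exfalso.
- assert (0 < (- l1 + l2 + l3) * (l1 - l2 + l3)) by (apply Rmult_lt_0_compat; lra); nra.
- assert (0 < (- l1 + l2 + l3) * (l1 + l2 - l3)) by (apply Rmult_lt_0_compat; lra); nra.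
- assert (0 < (l1 - l2 + l3) * (l1 + l2 - l3)) by (apply Rmult_lt_0_compat; lra); nra.
Qed.

(** * Circumellipse centered at the Mittenpunkt *)

(** The cross products at [X] are its barycentric coordinates up to scale, and collinearity is
    linear in them. *)
Lemma mittenpunkt_line (P Q R X : pt) :
  - dist Q R + dist R P + dist P Q <> 0 ->
  on_line (excenter P Q R) (midpoint Q R) X ->
  dist Q R * (cross (psub P X) (psub Q X) - cross (psub R X) (psub P X))
    + (dist P Q - dist R P) * cross (psub Q X) (psub R X) = 0.
Proof.
intros s0; unfold on_line, excenter, midpoint; cbv zeta.
set (lP := dist Q R) in *; set (lQ := dist R P) in *; set (lR := dist P Q) in *.
clearbody lP lQ lR.
intros H.
apply Rmult_eq_reg_l with (- / (2 * (- lP + lQ + lR)));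
  [| apply Ropp_neq_0_compat, Rinv_neq_0_compat; lra].
rewrite Rmult_0_r, <- H; unfold cross, psub, padd, pscale; simpl; field; lra.
Qed.

(** Take squared norms in m1 w_1 + m2 w_2 = - m3 w_3. *)
Lemma gram_entry (m1 m2 m3 X1 Y1 X2 Y2 X3 Y3 : R) :
  X1 ^ 2 + Y1 ^ 2 = 1 -> X2 ^ 2 + Y2 ^ 2 = 1 -> X3 ^ 2 + Y3 ^ 2 = 1 ->
  m1 * X1 + m2 * X2 + m3 * X3 = 0 -> m1 * Y1 + m2 * Y2 + m3 * Y3 = 0 ->
  2 * m1 * m2 * (1 - (X1 * X2 + Y1 * Y2)) = (m1 + m2) ^ 2 - m3 ^ 2.
Proof.
intros U1 U2 U3 Cx Cy.
apply (Req_sub _ _ _ (lincomb (m1 ^ 2) U1 (lincomb (m2 ^ 2) U2 (lincomb (- m3 ^ 2) U3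
  (lincomb (- (m1 * X1 + m2 * X2 - m3 * X3)) Cx
  (lincomb (- (m1 * Y1 + m2 * Y2 - m3 * Y3)) Cy eq_refl)))))); ring.
Qed.

Section Triangle.

Variables (A B X1 Y1 X2 Y2 X3 Y3 l1 l2 l3 : R).
Hypotheses (A0 : 0 < A) (B0 : 0 < B) (p1 : 0 < l1) (p2 : 0 < l2) (p3 : 0 < l3).
Hypotheses (U1 : X1 ^ 2 + Y1 ^ 2 = 1) (U2 : X2 ^ 2 + Y2 ^ 2 = 1)
  (U3 : X3 ^ 2 + Y3 ^ 2 = 1).
Hypotheses (L1 : l1 ^ 2 = A ^ 2 * (X2 - X3) ^ 2 + B ^ 2 * (Y2 - Y3) ^ 2)
  (L2 : l2 ^ 2 = A ^ 2 * (X3 - X1) ^ 2 + B ^ 2 * (Y3 - Y1) ^ 2)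
  (L3 : l3 ^ 2 = A ^ 2 * (X1 - X2) ^ 2 + B ^ 2 * (Y1 - Y2) ^ 2).

(** Up to a common factor, x, y, z are the barycentric coordinates of the center; x + y + z is twice
    the signed area in the frame. *)
Let x := X2 * Y3 - Y2 * X3.
Let y := X3 * Y1 - Y3 * X1.
Let z := X1 * Y2 - Y1 * X2.
Let M := 4 * (l1 * l2 + l2 * l3 + l3 * l1) - (l1 + l2 + l3) ^ 2.

Hypothesis D0 : x + y + z <> 0.

(** Heron's formula for 16 area^2, the frame scaling areas by A B. *)
Lemma heron_affine :
  (l1 + l2 + l3) * ((- l1 + l2 + l3) * (l1 - l2 + l3) * (l1 + l2 - l3))
    = 4 * (A * B) ^ 2 * (x + y + z) ^ 2.
Proof.
transitivity (2 * (l1 ^ 2 * l2 ^ 2 + l2 ^ 2 * l3 ^ 2 + l3 ^ 2 * l1 ^ 2)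
              - ((l1 ^ 2) ^ 2 + (l2 ^ 2) ^ 2 + (l3 ^ 2) ^ 2)); [ring |].
rewrite L1, L2, L3; unfold x, y, z; ring.
Qed.

Lemma triangle_ineq_affine :
  0 < - l1 + l2 + l3 /\ 0 < l1 - l2 + l3 /\ 0 < l1 + l2 - l3.
Proof.
apply heron_triangle_ineq; auto.
rewrite heron_affine.
assert (0 < A * B) by (apply Rmult_lt_0_compat; auto).
apply Rmult_lt_0_compat; [apply Rmult_lt_0_compat; [lra |] |]; rewrite <- Rsqr_pow2;
  apply Rsqr_pos_lt; auto; lra.
Qed.

Hypotheses (H1 : l1 * (z - y) + (l3 - l2) * x = 0)
  (H2 : l2 * (x - z) + (l1 - l3) * y = 0)
  (H3 : l3 * (y - x) + (l2 - l1) * z = 0).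

(* The center has barycentric coordinates m_i = l_i (l_j + l_k - l_i); the Gram
   matrix of three unit vectors w_i with m_1 w_1 + m_2 w_2 + m_3 w_3 = 0 is
   determined by the m_i. *)
Lemma mittenpunkt_gram :
  0 < M /\
  1 - (X1 * X2 + Y1 * Y2) = M / (2 * l1 * l2) /\
  1 - (X2 * X3 + Y2 * Y3) = M / (2 * l2 * l3) /\
  1 - (X3 * X1 + Y3 * Y1) = M / (2 * l3 * l1).
Proof.
destruct triangle_ineq_affine as [s1 [s2 s3]].
set (m1 := l1 * (- l1 + l2 + l3)).
set (m2 := l2 * (l1 - l2 + l3)).
set (m3 := l3 * (l1 + l2 - l3)).
assert (m1p : 0 < m1) by (apply Rmult_lt_0_compat; auto).
assert (m2p : 0 < m2) by (apply Rmult_lt_0_compat; auto).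
assert (m3p : 0 < m3) by (apply Rmult_lt_0_compat; auto).
assert (EM : M = m1 + m2 + m3) by (unfold M, m1, m2, m3; ring).
assert (R12 : x * m2 = y * m1).
{ unfold m1, m2; lincomb2 l2 H1 l1 H2. }
assert (R23 : y * m3 = z * m2).
{ unfold m2, m3; lincomb2 l3 H2 l2 H3. }
assert (lam : exists r, r <> 0 /\ x = r * m1 /\ y = r * m2 /\ z = r * m3).
{ exists (y / m2).
  assert (x = y / m2 * m1).
  { apply Rmult_eq_reg_r with m2; [rewrite R12; field; lra | lra]. }
  assert (y = y / m2 * m2) by (field; lra).
  assert (z = y / m2 * m3).
  { apply Rmult_eq_reg_r with m2; [rewrite <- R23; field; lra | lra]. }
  repeat split; auto.
  intros r0; apply D0; rewrite r0 in *; lra. }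
destruct lam as [r [r0 [rx [ry rz]]]].
(* x w_1 + y w_2 + z w_3 = 0 holds for any three plane vectors; cancel r. *)
assert (Cx : m1 * X1 + m2 * X2 + m3 * X3 = 0).
{ apply Rmult_eq_reg_l with r; auto.
  transitivity (x * X1 + y * X2 + z * X3); [rewrite rx, ry, rz; ring |].
  unfold x, y, z; ring. }
assert (Cy : m1 * Y1 + m2 * Y2 + m3 * Y3 = 0).
{ apply Rmult_eq_reg_l with r; auto.
  transitivity (x * Y1 + y * Y2 + z * Y3); [rewrite rx, ry, rz; ring |].
  unfold x, y, z; ring. }
split; [lra |].
clear rx ry rz r0 R12 R23.
assert (G12 := gram_entry _ _ _ _ _ _ _ _ _ U1 U2 U3 Cx Cy).
assert (G23 := gram_entry m2 m3 m1 _ _ _ _ _ _ U2 U3 U1 ltac:(lra) ltac:(lra)).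
assert (G31 := gram_entry m3 m1 m2 _ _ _ _ _ _ U3 U1 U2 ltac:(lra) ltac:(lra)).
split; [| split].
- apply Rmult_eq_reg_l with (2 * m1 * m2).
  + rewrite G12; unfold M, m1, m2, m3; field; lra.
  + apply Rgt_not_eq; repeat apply Rmult_lt_0_compat; lra.
- apply Rmult_eq_reg_l with (2 * m2 * m3).
  + rewrite G23; unfold M, m1, m2, m3; field; lra.
  + apply Rgt_not_eq; repeat apply Rmult_lt_0_compat; lra.
- apply Rmult_eq_reg_l with (2 * m3 * m1).
  + rewrite G31; unfold M, m1, m2, m3; field; lra.
  + apply Rgt_not_eq; repeat apply Rmult_lt_0_compat; lra.
Qed.

Lemma mittenpunkt_axes :
  let p := l1 + l2 + l3 in let r := M / (l1 * l2 * l3) in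
  0 < r /\
  r ^ 2 * (A ^ 2 + B ^ 2) = 2 * (p * r - 6) /\
  r ^ 3 * (A ^ 2 * B ^ 2) = p * (p * r - 8).
Proof.
destruct mittenpunkt_gram as [M0 [G12 [G23 G31]]]; cbv zeta.
assert (T0 : 0 < l1 * l2 * l3) by (repeat apply Rmult_lt_0_compat; auto).
set (r := M / (l1 * l2 * l3)).
assert (r0 : 0 < r) by (apply Rdiv_lt_0_compat; auto).
assert (EM : M = r * (l1 * l2 * l3)) by (unfold r; field; lra).
assert (C1 : (X2 - X3) ^ 2 + (Y2 - Y3) ^ 2 = r * l1).
{ transitivity (M / (l2 * l3)); [| rewrite EM; field; lra].
  transitivity (2 * (1 - (X2 * X3 + Y2 * Y3))); [lra | rewrite G23; field; lra]. }
assert (C2 : (X3 - X1) ^ 2 + (Y3 - Y1) ^ 2 = r * l2).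
{ transitivity (M / (l3 * l1)); [| rewrite EM; field; lra].
  transitivity (2 * (1 - (X3 * X1 + Y3 * Y1))); [lra | rewrite G31; field; lra]. }
assert (C3 : (X1 - X2) ^ 2 + (Y1 - Y2) ^ 2 = r * l3).
{ transitivity (M / (l1 * l2)); [| rewrite EM; field; lra].
  transitivity (2 * (1 - (X1 * X2 + Y1 * Y2))); [lra | rewrite G12; field; lra]. }
(* Heron's formula in the frame, where the squared sides are r l_i. *)
assert (W : 4 * (x + y + z) ^ 2 = r ^ 2 * M).
{ set (g1 := (X2 - X3) ^ 2 + (Y2 - Y3) ^ 2) in *.
  set (g2 := (X3 - X1) ^ 2 + (Y3 - Y1) ^ 2) in *.
  set (g3 := (X1 - X2) ^ 2 + (Y1 - Y2) ^ 2) in *.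
  transitivity (2 * (g1 * g2 + g2 * g3 + g3 * g1) - (g1 ^ 2 + g2 ^ 2 + g3 ^ 2)).
  - unfold g1, g2, g3, x, y, z; ring.
  - rewrite C1, C2, C3; unfold M; ring. }
(* The trace of the form A^2 X^2 + B^2 Y^2, recovered from its values l_i^2 on the edges. *)
assert (T : 2 * (x + y + z) ^ 2 * (A ^ 2 + B ^ 2)
    = l1 ^ 2 * (r * l2 + r * l3 - r * l1) + l2 ^ 2 * (r * l3 + r * l1 - r * l2)
      + l3 ^ 2 * (r * l1 + r * l2 - r * l3)).
{ rewrite <- C1, <- C2, <- C3, L1, L2, L3; unfold x, y, z; ring. }
split; [exact r0 | split].
- apply Rmult_eq_reg_l with (r * (l1 * l2 * l3)).
  2: { apply Rgt_not_eq, Rmult_lt_0_compat; auto. }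
  transitivity (2 * (2 * (x + y + z) ^ 2 * (A ^ 2 + B ^ 2))).
  + transitivity (4 * (x + y + z) ^ 2 * (A ^ 2 + B ^ 2)); [| ring].
    rewrite W, EM; ring.
  + rewrite T.
    transitivity (2 * r * ((l1 + l2 + l3) * M - 6 * (l1 * l2 * l3)));
      [unfold M | rewrite EM]; ring.
- apply Rmult_eq_reg_l with (l1 * l2 * l3); [| lra].
  transitivity (4 * (A * B) ^ 2 * (x + y + z) ^ 2).
  + transitivity ((A * B) ^ 2 * (4 * (x + y + z) ^ 2)); [| ring].
    rewrite W, EM; ring.
  + rewrite <- heron_affine.
    transitivity ((l1 + l2 + l3) * ((l1 + l2 + l3) * M - 8 * (l1 * l2 * l3)));
      [unfold M | rewrite EM]; ring.
Qed.

End Triangle.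

Definition perimeter (P1 P2 P3 : pt) : R := dist P2 P3 + dist P3 P1 + dist P1 P2.

(* Equals 2 (4 + r / R) / perimeter, with r the inradius and R the circumradius. *)
Definition mitten_ratio (P1 P2 P3 : pt) : R :=
  (4 * (dist P2 P3 * dist P3 P1 + dist P3 P1 * dist P1 P2 + dist P1 P2 * dist P2 P3)
   - perimeter P1 P2 P3 ^ 2) / (dist P2 P3 * dist P3 P1 * dist P1 P2).

(** Stated for an arbitrary triangle: the billiard law comes from the Mittenpunkt alone, and the
    last two equations determine the unordered pair of axes. *)
Lemma mittenpunkt_circumellipse (P1 P2 P3 X u : pt) (A B : R) :
  P1 <> P2 -> P2 <> P3 -> P3 <> P1 ->
  is_mittenpunkt P1 P2 P3 X -> is_circumellipse X u A B P1 P2 P3 ->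
  let p := perimeter P1 P2 P3 in let r := mitten_ratio P1 P2 P3 in
  is_3periodic X u A B P1 P2 P3 /\ 0 < r /\
  r ^ 2 * (A ^ 2 + B ^ 2) = 2 * (p * r - 6) /\
  r ^ 3 * (A ^ 2 * B ^ 2) = p * (p * r - 8).
Proof.
intros N12 N23 N31 [M1 [M2 M3]] [E [O1 [O2 O3]]].
assert (A0 : 0 < A) by apply E.
assert (B0 : 0 < B) by apply E.
assert (p1 := dist_gt0 _ _ N23); assert (p2 := dist_gt0 _ _ N31);
  assert (p3 := dist_gt0 _ _ N12).
assert (U1 := frame_unit _ _ _ _ E _ O1); assert (U2 := frame_unit _ _ _ _ E _ O2);
  assert (U3 := frame_unit _ _ _ _ E _ O3).
assert (D0 := unit_cross_neq0 _ _ _ _ _ _ U1 U2 U3 (frame_inj _ _ _ _ E _ _ N12)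
  (frame_inj _ _ _ _ E _ _ N23) (frame_inj _ _ _ _ E _ _ N31)).
assert (L1 := frame_dist _ _ _ _ E P2 P3); assert (L2 := frame_dist _ _ _ _ E P3 P1);
  assert (L3 := frame_dist _ _ _ _ E P1 P2).
destruct (triangle_ineq_affine A B _ _ _ _ _ _ _ _ _ A0 B0 p1 p2 p3 L1 L2 L3 D0)
  as [s1 [s2 s3]].
apply mittenpunkt_line in M1; [| lra].
apply mittenpunkt_line in M2; [| lra].
apply mittenpunkt_line in M3; [| lra].
rewrite !(frame_cross _ _ _ _ E) in M1, M2, M3.
assert (AB : A * B <> 0) by (apply Rgt_not_eq, Rmult_lt_0_compat; auto).
set (X1 := frame_x X u A P1) in *; set (Y1 := frame_y X u B P1) in *.
set (X2 := frame_x X u A P2) in *; set (Y2 := frame_y X u B P2) in *.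
set (X3 := frame_x X u A P3) in *; set (Y3 := frame_y X u B P3) in *.
assert (H1 : dist P2 P3 * ((X1 * Y2 - Y1 * X2) - (X3 * Y1 - Y3 * X1))
  + (dist P1 P2 - dist P3 P1) * (X2 * Y3 - Y2 * X3) = 0)
  by (apply Rmult_eq_reg_l with (A * B); lra).
assert (H2 : dist P3 P1 * ((X2 * Y3 - Y2 * X3) - (X1 * Y2 - Y1 * X2))
  + (dist P2 P3 - dist P1 P2) * (X3 * Y1 - Y3 * X1) = 0)
  by (apply Rmult_eq_reg_l with (A * B); lra).
assert (H3 : dist P1 P2 * ((X3 * Y1 - Y3 * X1) - (X2 * Y3 - Y2 * X3))
  + (dist P3 P1 - dist P2 P3) * (X1 * Y2 - Y1 * X2) = 0)
  by (apply Rmult_eq_reg_l with (A * B); lra).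
assert (G := mittenpunkt_gram A B _ _ _ _ _ _ _ _ _ A0 B0 p1 p2 p3 U1 U2 U3 L1 L2 L3 D0
  H1 H2 H3).
assert (K := mittenpunkt_axes A B _ _ _ _ _ _ _ _ _ A0 B0 p1 p2 p3 U1 U2 U3 L1 L2 L3 D0
  H1 H2 H3).
split; [| exact K].
destruct G as [_ [G12 [G23 G31]]].
repeat (split; [assumption |]).
split; [| split]; apply bisects_angle_ellipse; auto; fold X1 X2 X3 Y1 Y2 Y3.
- rewrite (dist_sym P1 P3).
  replace (X1 * X2 + Y1 * Y2 - 1) with (- (1 - (X1 * X2 + Y1 * Y2))) by ring.
  replace (X1 * X3 + Y1 * Y3 - 1) with (- (1 - (X3 * X1 + Y3 * Y1))) by ring.
  rewrite G12, G31; field; lra.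
- rewrite (dist_sym P2 P1).
  replace (X2 * X3 + Y2 * Y3 - 1) with (- (1 - (X2 * X3 + Y2 * Y3))) by ring.
  replace (X2 * X1 + Y2 * Y1 - 1) with (- (1 - (X1 * X2 + Y1 * Y2))) by ring.
  rewrite G12, G23; field; lra.
- rewrite (dist_sym P3 P2).
  replace (X3 * X1 + Y3 * Y1 - 1) with (- (1 - (X3 * X1 + Y3 * Y1))) by ring.
  replace (X3 * X2 + Y3 * Y2 - 1) with (- (1 - (X2 * X3 + Y2 * Y3))) by ring.
  rewrite G31, G23; field; lra.
Qed.

(** * Triangles of the elliptic billiard *)

(** On the unit circle l^2 has the factor 1 - w_1.w_2; squaring kap l = 1 - w_1.w_2 and cancelling
    it leaves a bilinear equation. *)
Lemma chord_relation (a b kap l X1 Y1 X2 Y2 : R) :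
  X1 ^ 2 + Y1 ^ 2 = 1 -> X2 ^ 2 + Y2 ^ 2 = 1 -> X1 * X2 + Y1 * Y2 < 1 ->
  l ^ 2 = a ^ 2 * (X1 - X2) ^ 2 + b ^ 2 * (Y1 - Y2) ^ 2 ->
  kap * l = 1 - (X1 * X2 + Y1 * Y2) ->
  let k := kap ^ 2 * (a ^ 2 - b ^ 2) in
  (1 - k) * (X1 * X2) + (1 + k) * (Y1 * Y2) = 1 - kap ^ 2 * (a ^ 2 + b ^ 2).
Proof.
intros U1 U2 G L K k; unfold k.
assert (F : l ^ 2 = (1 - (X1 * X2 + Y1 * Y2))
    * (a ^ 2 + b ^ 2 - (a ^ 2 - b ^ 2) * (X1 * X2 - Y1 * Y2))).
{ rewrite L.
  lincomb2 (a ^ 2 * Y2 ^ 2 + b ^ 2 * X2 ^ 2) U1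
    (a ^ 2 * (1 - X1 ^ 2) + b ^ 2 * (1 - Y1 ^ 2)) U2. }
apply Rmult_eq_reg_l with (1 - (X1 * X2 + Y1 * Y2)); [| lra].
assert (S : (kap * l) ^ 2 = (1 - (X1 * X2 + Y1 * Y2)) ^ 2) by (rewrite K; ring).
lincomb2 (- kap ^ 2) F 1 S.
Qed.

Lemma chord_length (k gam X1 Y1 X2 Y2 : R) :
  0 < k -> 2 * gam = k ^ 2 - 1 ->
  (1 - k) * (X1 * X2) + (1 + k) * (Y1 * Y2) = gam ->
  1 - (X1 * X2 + Y1 * Y2) = (3 - k) / 2 - 2 * k / (1 + k) * (X1 * X2).
Proof.
intros k0 G E.
apply Rmult_eq_reg_l with (1 + k); [| lra].
apply (Req_sub _ _ _ (lincomb (-1) E (lincomb (- / 2) G eq_refl))); field; lra.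
Qed.

(** What remains of a billiard triangle once the ordinates are eliminated. [kap] is Joachimsthal's
    invariant, fixed by the equation between c, k and a. *)
Definition billiard_chords (a c kap l1 l2 l3 X1 X2 X3 : R) : Prop :=
  let k := kap ^ 2 * c ^ 2 in
  let chord X Y := (3 - k) / 2 - 2 * k / (1 + k) * (X * Y) in
  0 < kap /\ 0 < k < 1 /\
  c ^ 2 * ((3 - k) * (k + 1)) = 4 * k * a ^ 2 /\
  4 * (X1 * X2 + X2 * X3 + X3 * X1) = (k - 3) * (k + 1) /\
  4 * k * (X1 * X2 * X3) = - (1 + k) ^ 2 * (X1 + X2 + X3) /\
  kap * l1 = chord X2 X3 /\ kap * l2 = chord X3 X1 /\ kap * l3 = chord X1 X2.

Lemma is_ellipse_origin (a b : R) : 0 < a -> 0 < b -> is_ellipse origin e1 a b.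
Proof.
intros; split; [| auto].
unfold norm, dot, e1; simpl.
transitivity (sqrt 1); [f_equal; ring | apply sqrt_1].
Qed.

Lemma billiard_chords_3periodic (a b : R) (P1 P2 P3 : pt) :
  0 < b -> b < a -> is_3periodic origin e1 a b P1 P2 P3 ->
  exists kap, billiard_chords a (sqrt (a ^ 2 - b ^ 2)) kap
    (dist P2 P3) (dist P3 P1) (dist P1 P2) (fst P1 / a) (fst P2 / a) (fst P3 / a).
Proof.
intros b0 ab [N12 [N23 [N31 [O1 [O2 [O3 [B1 [B2 B3]]]]]]]].
assert (E : is_ellipse origin e1 a b) by (apply is_ellipse_origin; lra).
assert (Xa : forall P, frame_x origin e1 a P = fst P / a).
{ intros; unfold frame_x, dot, psub, origin, e1; simpl; f_equal; ring. }
apply bisects_angle_ellipse in B1, B2, B3; auto.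
assert (p1 := dist_gt0 _ _ N23); assert (p2 := dist_gt0 _ _ N31);
  assert (p3 := dist_gt0 _ _ N12).
assert (U1 := frame_unit _ _ _ _ E _ O1); assert (U2 := frame_unit _ _ _ _ E _ O2);
  assert (U3 := frame_unit _ _ _ _ E _ O3).
assert (F12 := frame_inj _ _ _ _ E _ _ N12); assert (F23 := frame_inj _ _ _ _ E _ _ N23);
  assert (F31 := frame_inj _ _ _ _ E _ _ N31).
assert (L1 := frame_dist _ _ _ _ E P2 P3); assert (L2 := frame_dist _ _ _ _ E P3 P1);
  assert (L3 := frame_dist _ _ _ _ E P1 P2).
rewrite !Xa in *.
set (X1 := fst P1 / a) in *; set (Y1 := frame_y origin e1 b P1) in *.
set (X2 := fst P2 / a) in *; set (Y2 := frame_y origin e1 b P2) in *.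
set (X3 := fst P3 / a) in *; set (Y3 := frame_y origin e1 b P3) in *.
assert (G12 := unit_dot_lt1 _ _ _ _ U1 U2 F12).
assert (G23 := unit_dot_lt1 _ _ _ _ U2 U3 F23).
assert (G31 := unit_dot_lt1 _ _ _ _ U3 U1 F31).
rewrite (dist_sym P1 P3) in B1; rewrite (dist_sym P2 P1) in B2.
set (l1 := dist P2 P3) in *; set (l2 := dist P3 P1) in *; set (l3 := dist P1 P2) in *.
clearbody X1 X2 X3 Y1 Y2 Y3 l1 l2 l3; clear B3.
(* Read off the side P1 P2; the laws at P1 and P2 carry this ratio to the other two sides. *)
set (kap := (1 - (X1 * X2 + Y1 * Y2)) / l3).
assert (kap0 : 0 < kap) by (apply Rdiv_lt_0_compat; lra).
assert (K3 : kap * l3 = 1 - (X1 * X2 + Y1 * Y2)) by (unfold kap; field; lra).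
assert (K2 : kap * l2 = 1 - (X3 * X1 + Y3 * Y1)).
{ replace kap with (- ((X1 * X2 + Y1 * Y2 - 1) / l3)) by (unfold kap; field; lra).
  rewrite B1; field; lra. }
assert (K1 : kap * l1 = 1 - (X2 * X3 + Y2 * Y3)).
{ replace kap with (- ((X2 * X1 + Y2 * Y1 - 1) / l3)) by (unfold kap; field; lra).
  rewrite <- B2; field; lra. }
clearbody kap; clear B1 B2.
assert (c0 : 0 < a ^ 2 - b ^ 2) by (clear - b0 ab; nra).
assert (c2 : sqrt (a ^ 2 - b ^ 2) ^ 2 = a ^ 2 - b ^ 2) by (rewrite pow2_sqrt; lra).
exists kap; unfold billiard_chords; rewrite c2; cbv zeta.
assert (E12 := chord_relation a b _ _ _ _ _ _ U1 U2 G12 L3 K3).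
assert (E23 := chord_relation a b _ _ _ _ _ _ U2 U3 G23 L1 K1).
assert (E31 := chord_relation a b _ _ _ _ _ _ U3 U1 G31 L2 K2).
cbv zeta in E12, E23, E31.
set (k := kap ^ 2 * (a ^ 2 - b ^ 2)) in *.
assert (k0 : 0 < k) by (apply Rmult_lt_0_compat; [apply pow_lt |]; lra).
assert (g0 : 1 - kap ^ 2 * (a ^ 2 + b ^ 2) < 3 / 2).
{ assert (0 < kap ^ 2 * (a ^ 2 + b ^ 2)); [| lra].
  apply Rmult_lt_0_compat; [apply pow_lt; lra | clear - b0 c0; nra]. }
destruct (chord_triangle k _ _ _ _ _ _ _ k0 g0 U1 U2 U3 F12 F23 F31 E12 E23 E31)
  as [Hg [H2 H3]].
assert (Hc : (a ^ 2 - b ^ 2) * ((3 - k) * (k + 1)) = 4 * k * a ^ 2).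
{ apply (Req_sub _ _ _ (lincomb (a ^ 2 - b ^ 2) Hg eq_refl)); unfold k; ring. }
assert (kb : 0 < k * b ^ 2) by (apply Rmult_lt_0_compat; [| apply pow_lt]; lra).
(* Subtracting 4 k c^2 from [Hc] leaves c^2 (1 - k)(k + 3) = 4 k b^2 > 0. *)
assert (k1 : k < 1).
{ assert (P : (a ^ 2 - b ^ 2) * ((1 - k) * (k + 3)) = 4 * (k * b ^ 2)) by lra.
  clear - c0 k0 kb P.
  destruct (Rlt_le_dec k 1) as [|k1]; auto; exfalso.
  assert (0 <= (a ^ 2 - b ^ 2) * ((k - 1) * (k + 3)))
    by (apply Rmult_le_pos; [lra | apply Rmult_le_pos; lra]).
  lra. }
rewrite K1, K2, K3.
repeat (split; auto); eapply chord_length; eauto.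
Qed.

(** * Focus-inversive triangles *)

Lemma on_ellipse_standard (a b : R) (P : pt) :
  on_ellipse origin e1 a b P -> (fst P) ^ 2 / a ^ 2 + (snd P) ^ 2 / b ^ 2 = 1.
Proof.
intros O; rewrite <- O; unfold Rdiv; f_equal; f_equal; f_equal;
  unfold dot, psub, perp, origin, e1; simpl; ring.
Qed.

(** The squared focal distance is (a + c X)^2 because b^2 = a^2 - c^2; the sign follows from |X| <=
    1 and c < a. *)
Lemma dist_focus (a b : R) (P : pt) :
  0 < b -> b < a -> on_ellipse origin e1 a b P ->
  dist P (focus1 a b) = a + sqrt (a ^ 2 - b ^ 2) * (fst P / a) /\
  0 < dist P (focus1 a b).
Proof.
intros b0 ab O; apply on_ellipse_standard in O.
assert (c0 : 0 < a ^ 2 - b ^ 2) by (clear - b0 ab; nra).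
assert (D := dist_sqr P (focus1 a b)).
change (fst (focus1 a b)) with (- sqrt (a ^ 2 - b ^ 2)) in D.
change (snd (focus1 a b)) with 0 in D.
assert (c2 : sqrt (a ^ 2 - b ^ 2) ^ 2 = a ^ 2 - b ^ 2) by (rewrite pow2_sqrt; lra).
assert (cp := sqrt_lt_R0 _ c0).
assert (d0 := dist_ge0 P (focus1 a b)).
set (c := sqrt (a ^ 2 - b ^ 2)) in *; clearbody c.
set (d := dist P (focus1 a b)) in *; clearbody d.
destruct P as [p q]; simpl fst in *; simpl snd in *.
set (X := p / a) in *.
assert (Ep : p = a * X) by (unfold X; field; lra).
assert (Eq : q ^ 2 = b ^ 2 * (1 - X ^ 2)).
{ apply Rmult_eq_reg_r with (/ b ^ 2); [| apply Rinv_neq_0_compat, pow_nonzero; lra].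
  change (q ^ 2 / b ^ 2 = b ^ 2 * (1 - X ^ 2) / b ^ 2).
  transitivity (1 - X ^ 2); [| field; lra].
  rewrite <- O; unfold X; field; lra. }
clearbody X; clear O.
assert (X1 : -1 <= X <= 1).
{ assert (0 <= q ^ 2) by apply pow2_ge_0.
  assert (0 < b ^ 2) by (apply pow_lt; lra).
  assert (H1 : 0 <= 1 - X ^ 2) by (apply Rmult_le_reg_l with (b ^ 2); lra).
  clear - H1; nra. }
assert (ca : c < a) by (clear - b0 ab cp c2; nra).
assert (pos : 0 < a + c * X) by (clear - ca cp X1; nra).
assert (D2 : (d - (a + c * X)) * (d + (a + c * X)) = 0).
{ apply (Req_sub _ _ _ (lincomb 1 D (lincomb 1 Eq (lincomb (1 - X ^ 2) c2 eq_refl)))).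
  subst p; ring. }
apply Rmult_integral in D2; lra.
Qed.

(** Law of cosines at f: inversion keeps the angle and replaces the radii s, t by rho^2 / s, rho^2 /
    t. *)
Lemma dist_invert (f : pt) (rho : R) (p q : pt) :
  0 < dist p f -> 0 < dist q f ->
  dist (invert f rho p) (invert f rho q)
    = rho ^ 2 * dist p q / (dist p f * dist q f).
Proof.
intros p0 q0.
assert (Hp := dist_sqr p f); assert (Hq := dist_sqr q f); assert (H := dist_sqr p q).
assert (d0 := dist_ge0 p q).
apply Rsqr_inj.
- apply dist_ge0.
- apply Rmult_le_pos; [apply Rmult_le_pos; [apply pow2_ge_0 | auto] |].
  apply Rlt_le, Rinv_0_lt_compat, Rmult_lt_0_compat; auto.
- rewrite !Rsqr_pow2, dist_sqr.
  unfold invert, padd, pscale, psub; simpl fst; simpl snd.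
  set (s := dist p f) in *; set (t := dist q f) in *; set (l := dist p q) in *.
  clearbody s t l.
  destruct p as [p1 p2], q as [q1 q2], f as [f1 f2]; simpl fst in *; simpl snd in *.
  transitivity (rho ^ 4 * (s ^ 2 + t ^ 2
    - 2 * ((p1 - f1) * (q1 - f1) + (p2 - f2) * (q2 - f2))) / (s ^ 2 * t ^ 2)).
  + transitivity (((rho / s) ^ 2) ^ 2 * ((p1 - f1) ^ 2 + (p2 - f2) ^ 2)
      + ((rho / t) ^ 2) ^ 2 * ((q1 - f1) ^ 2 + (q2 - f2) ^ 2)
      - 2 * ((rho / s) ^ 2 * (rho / t) ^ 2)
          * ((p1 - f1) * (q1 - f1) + (p2 - f2) * (q2 - f2))); [ring |].
    rewrite <- Hp, <- Hq; field; lra.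
  + transitivity (rho ^ 4 * l ^ 2 / (s ^ 2 * t ^ 2)); [| field; lra].
    rewrite H, Hp, Hq; f_equal; ring.
Qed.

(** The quadratic for k has root product -3, hence a single positive root; eliminating a^2 between
    two instances shows this without solving. *)
Lemma billiard_chords_kap_inj (a c kap kap' l1 l2 l3 X1 X2 X3 l1' l2' l3' X1' X2' X3' : R) :
  billiard_chords a c kap l1 l2 l3 X1 X2 X3 ->
  billiard_chords a c kap' l1' l2' l3' X1' X2' X3' -> kap = kap'.
Proof.
intros [p0 [k0 [Hk _]]] [p0' [k0' [Hk' _]]].
set (k := kap ^ 2 * c ^ 2) in *; set (k' := kap' ^ 2 * c ^ 2) in *.
assert (c0 : c ^ 2 <> 0) by (intros H; unfold k in k0; rewrite H in k0; lra).
assert (K : (c ^ 2 * (3 + k * k')) * (k - k') = 0).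
{ lincomb2 k Hk' (- k') Hk. }
assert (0 < k * k') by (apply Rmult_lt_0_compat; lra).
apply Rmult_integral in K; destruct K as [K | K].
- apply Rmult_integral in K; lra.
- assert (S : kap ^ 2 = kap' ^ 2).
  { apply Rmult_eq_reg_r with (c ^ 2); auto; unfold k, k' in K; lra. }
  rewrite <- !Rsqr_pow2 in S; apply Rsqr_inj; auto; lra.
Qed.

(** The inversive sides are rho^2 l_i d_i / (d1 d2 d3), so [chord_family], applied to the lengths
    kap l_i, evaluates both quantities. *)
Lemma focus_inversive_invariants (a b rho kap : R) (P1 P2 P3 : pt) :
  0 < b -> b < a -> 0 < rho -> is_3periodic origin e1 a b P1 P2 P3 ->
  let c := sqrt (a ^ 2 - b ^ 2) in let k := kap ^ 2 * c ^ 2 in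
  let Q P := invert (focus1 a b) rho P in
  billiard_chords a c kap (dist P2 P3) (dist P3 P1) (dist P1 P2)
    (fst P1 / a) (fst P2 / a) (fst P3 / a) ->
  perimeter (Q P1) (Q P2) (Q P3)
    = rho ^ 2 * ((3 + k) * (3 - k)) / (2 * kap * a ^ 2 * (1 - k)) /\
  mitten_ratio (Q P1) (Q P2) (Q P3)
    = 2 * kap * a ^ 2 * ((3 + k) * (1 - k)) / (rho ^ 2 * ((3 - k) * (1 + k))).
Proof.
intros b0 ab rho0 [N12 [N23 [N31 [O1 [O2 [O3 _]]]]]]; cbv zeta.
intros [kap0 [k01 [Hk [E2 [E3 [K1 [K2 K3]]]]]]].
destruct (dist_focus a b P1 b0 ab O1) as [D1 D1p].
destruct (dist_focus a b P2 b0 ab O2) as [D2 D2p].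
destruct (dist_focus a b P3 b0 ab O3) as [D3 D3p].
unfold perimeter, mitten_ratio, perimeter; rewrite !dist_invert; auto.
assert (p1 := dist_gt0 _ _ N23); assert (p2 := dist_gt0 _ _ N31);
  assert (p3 := dist_gt0 _ _ N12).
set (c := sqrt (a ^ 2 - b ^ 2)) in *; clearbody c.
set (k := kap ^ 2 * c ^ 2) in *; clearbody k.
destruct (chord_family a c k (2 * k / (1 + k)) ((3 - k) / 2) (fst P1 / a) (fst P2 / a)
  (fst P3 / a)) as [W T]; auto; try lra.
{ field; lra. }
rewrite <- K1, <- K2, <- K3, <- D1, <- D2, <- D3 in *.
set (l1 := dist P2 P3) in *; set (l2 := dist P3 P1) in *; set (l3 := dist P1 P2) in *.
set (d1 := dist P1 (focus1 a b)) in *; set (d2 := dist P2 (focus1 a b)) in *;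
  set (d3 := dist P3 (focus1 a b)) in *.
clearbody l1 l2 l3 d1 d2 d3; clear D1 D2 D3 K1 K2 K3 E2 E3 Hk.
assert (a0 : a <> 0) by lra.
split.
- transitivity (rho ^ 2 * (kap * l1 * d1 + kap * l2 * d2 + kap * l3 * d3)
    / (kap * (d1 * d2 * d3))); [field; lra |].
  replace (kap * l1 * d1 + kap * l2 * d2 + kap * l3 * d3)
    with ((3 + k) * (3 - k) * (d1 * d2 * d3) / (2 * a ^ 2 * (1 - k)))
    by (rewrite <- W; field; lra).
  field; lra.
(* The ratio is quadratic over cubic in the sides, and the product of the l_i d_i contains d1 d2 d3
   once, so the focal distances survive only in S. *)
- set (S := 4 * _ - _) in T.
  transitivity (kap * S / (rho ^ 2 * (kap * l1 * (kap * l2) * (kap * l3))));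
    [unfold S; field; lra |].
  replace S with (2 * a ^ 2 * (3 + k) * (1 - k) * (kap * l1 * (kap * l2) * (kap * l3))
    / ((3 - k) * (1 + k))) by (rewrite <- T; field; lra).
  field; lra.
Qed.

(** By Vieta, both pairs of squares are the roots of one quadratic. *)
Lemma sqr_pair_eq (A B C D : R) :
  0 < A -> 0 < B -> 0 < C -> 0 < D ->
  A ^ 2 + B ^ 2 = C ^ 2 + D ^ 2 -> A ^ 2 * B ^ 2 = C ^ 2 * D ^ 2 ->
  (A = C /\ B = D) \/ (A = D /\ B = C).
Proof.
intros A0 B0 C0 D0 S P.
assert (inj : forall x y, 0 < x -> 0 < y -> x ^ 2 = y ^ 2 -> x = y).
{ intros x y x0 y0 E; rewrite <- !Rsqr_pow2 in E; apply Rsqr_inj; auto; lra. }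
assert (K : (A ^ 2 - C ^ 2) * (A ^ 2 - D ^ 2) = 0) by lincomb2 (A ^ 2) S (-1) P.
apply Rmult_integral in K; destruct K; [left | right]; split; apply inj; lra.
Qed.

(** [p] and [r] involve only a, b, rho and [kap], and [kap] is common to the whole family by
    [billiard_chords_kap_inj]. *)
Lemma focus_inversive_circumellipse (a b rho A B : R) (P1 P2 P3 X9 u : pt) :
  0 < b -> b < a -> 0 < rho -> is_3periodic origin e1 a b P1 P2 P3 ->
  let c := sqrt (a ^ 2 - b ^ 2) in
  let Q P := invert (focus1 a b) rho P in
  is_mittenpunkt (Q P1) (Q P2) (Q P3) X9 ->
  is_circumellipse X9 u A B (Q P1) (Q P2) (Q P3) ->
  is_3periodic X9 u A B (Q P1) (Q P2) (Q P3) /\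
  exists kap, billiard_chords a c kap (dist P2 P3) (dist P3 P1) (dist P1 P2)
    (fst P1 / a) (fst P2 / a) (fst P3 / a) /\
  let k := kap ^ 2 * c ^ 2 in
  let p := rho ^ 2 * ((3 + k) * (3 - k)) / (2 * kap * a ^ 2 * (1 - k)) in
  let r := 2 * kap * a ^ 2 * ((3 + k) * (1 - k)) / (rho ^ 2 * ((3 - k) * (1 + k))) in
  0 < r /\
  r ^ 2 * (A ^ 2 + B ^ 2) = 2 * (p * r - 6) /\
  r ^ 3 * (A ^ 2 * B ^ 2) = p * (p * r - 8).
Proof.
intros b0 ab rho0 HP c Q HM HC.
destruct (billiard_chords_3periodic a b P1 P2 P3 b0 ab HP) as [kap Hk].
destruct (focus_inversive_invariants a b rho kap P1 P2 P3 b0 ab rho0 HP Hk) as [Ep Er].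
destruct HP as [N12 [N23 [N31 [O1 [O2 [O3 _]]]]]].
assert (NQ : forall P P', P <> P' -> on_ellipse origin e1 a b P ->
  on_ellipse origin e1 a b P' -> Q P <> Q P').
{ intros P P' N O O'; apply dist_gt0_neq; unfold Q.
  assert (d0 := proj2 (dist_focus a b P b0 ab O)).
  assert (d0' := proj2 (dist_focus a b P' b0 ab O')).
  rewrite dist_invert; auto.
  apply Rdiv_lt_0_compat; apply Rmult_lt_0_compat; auto.
  - apply pow_lt; auto.
  - apply dist_gt0; auto. }
destruct (mittenpunkt_circumellipse (Q P1) (Q P2) (Q P3) X9 u A B) as [H K]; auto.
split; [exact H |].
exists kap; split; [exact Hk |].
unfold Q in K; rewrite Ep, Er in K; exact K.
Qed.

Theorem mainTheorem5 (a b rho : R) :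
  0 < b -> b < a -> 0 < rho ->
  exists A0 B0 : R, 0 < A0 /\ 0 < B0 /\
  forall P1 P2 P3 : pt,
    is_3periodic origin e1 a b P1 P2 P3 ->
    forall X9 : pt,
      is_mittenpunkt (invert (focus1 a b) rho P1) (invert (focus1 a b) rho P2)
                     (invert (focus1 a b) rho P3) X9 ->
    forall (u : pt) (A B : R),
      is_circumellipse X9 u A B (invert (focus1 a b) rho P1)
        (invert (focus1 a b) rho P2) (invert (focus1 a b) rho P3) ->
      is_3periodic X9 u A B (invert (focus1 a b) rho P1)
        (invert (focus1 a b) rho P2) (invert (focus1 a b) rho P3) /\
      ((A = A0 /\ B = B0) \/ (A = B0 /\ B = A0)).
Proof.
intros b0 ab rho0.
(* All instances share kap, hence the symmetric functions of the squared axes,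
   so the axes of any one instance serve as A0, B0. *)
destruct (classic (exists P1 P2 P3 X9 u A B, is_3periodic origin e1 a b P1 P2 P3 /\
  is_mittenpunkt (invert (focus1 a b) rho P1) (invert (focus1 a b) rho P2)
    (invert (focus1 a b) rho P3) X9 /\
  is_circumellipse X9 u A B (invert (focus1 a b) rho P1)
    (invert (focus1 a b) rho P2) (invert (focus1 a b) rho P3))) as [I | I].
- destruct I as [P1' [P2' [P3' [X9' [u' [A0 [B0 [HP' [HM' HC']]]]]]]]].
  exists A0, B0.
  destruct (proj1 HC') as [_ [pA0 pB0]].
  split; [exact pA0 | split; [exact pB0 |]].
  intros P1 P2 P3 HP X9 HM u A B HC.
  destruct (proj1 HC) as [_ [pA pB]].
  destruct (focus_inversive_circumellipse a b rho A0 B0 P1' P2' P3' X9' u' b0 ab rho0 HP'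
    HM' HC') as [_ [kap' [Hk' [_ [S' T']]]]].
  destruct (focus_inversive_circumellipse a b rho A B P1 P2 P3 X9 u b0 ab rho0 HP
    HM HC) as [H [kap [Hk [r0 [S T]]]]].
  split; [exact H |].
  rewrite <- (billiard_chords_kap_inj _ _ _ _ _ _ _ _ _ _ _ _ _ _ _ _ Hk Hk') in S', T'.
  rewrite <- S' in S; rewrite <- T' in T.
  apply sqr_pair_eq; auto.
  + apply Rmult_eq_reg_l in S; [exact S | apply pow_nonzero; lra].
  + apply Rmult_eq_reg_l in T; [exact T | apply pow_nonzero; lra].
(* Without any instance the claim is vacuous, so arbitrary positive axes serve. *)
- exists 1, 1; split; [lra | split; [lra |]].
  intros P1 P2 P3 HP X9 HM u A B HC; exfalso; apply I.
  exists P1, P2, P3, X9, u, A, B; auto.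
Qed.
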